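(* Let $F\colon\mathcal C\to\mathcal D$ be a perfect tensor functor between finite tensor categories. A left $\mathcal D$-module category $\mathcal M$ is exact if and only if the $\mathcal C$-module category ${}_F\mathcal M$ is exact.
   Context: Work over an algebraically closed field $\Bbbk$. A finite tensor category is a finite $\Bbbk$-linear abelian rigid monoidal category with bilinear tensor product and $\mathrm{End}(\mathbb 1)\cong\Bbbk$; a tensor functor is an exact $\Bbbk$-linear strong monoidal functor. A tensor functor is perfect if its right adjoint is exact (equivalently, it preserves projective objects). A left $\mathcal D$-module category is a finite $\Bbbk$-linear abelian category $\mathcal M$ with a $\Bbbk$-bilinear action $\triangleright\colon\mathcal D\times\mathcal M\to\mathcal M$, exact in each variable, with coherent associativity isomorphisms. It is exact if $p\triangleright m$ is projective for every projective $p\in\mathcal D$ and every $m\in\mathcal M$. ${}_F\mathcal M$ is the category $\mathcal M$ with $\mathcal C$-action $c\triangleright^Fm=F(c)\triangleright m$. *)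

(* Defs.v *)
From mathcomp Require Import all_boot all_algebra.

Set Implicit Arguments.
Unset Strict Implicit.
Unset Printing Implicit Defensive.

Import GRing.Theory.
Local Open Scope ring_scope.

Declare Scope cat_scope.
Delimit Scope cat_scope with cat.
Local Open Scope cat_scope.

Reserved Notation "g \c f" (at level 50, left associativity).
Reserved Notation "x ⊗ y" (at level 40, left associativity).
Reserved Notation "f ⊗₁ g" (at level 40, left associativity).
Reserved Notation "x ▷ m" (at level 41, right associativity).
Reserved Notation "f ▷₁ g" (at level 41, right associativity).

(* Since Hom-spaces are [vectType]s, a [lincat] is by construction
   hom-finite. *)
Record lincat (k : fieldType) := LinCat {
  ob :> Type;
  mor : ob -> ob -> vectType k;
  idm : forall x, mor x x;
  mcomp : forall x y z, mor y z -> mor x y -> mor x z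
    where "g \c f" := (mcomp g f);
  mcomp1m : forall x y (f : mor x y), idm y \c f = f;
  mcompm1 : forall x y (f : mor x y), f \c idm x = f;
  mcompA : forall x y z t (h : mor z t) (g : mor y z) (f : mor x y),
    h \c (g \c f) = h \c g \c f;
  mcomp_linearr : forall x y z (g : mor y z), linear (@mcomp x y z g);
  mcomp_linearl : forall x y z (f : mor x y),
    linear (fun g : mor y z => g \c f)
}.
Arguments mor {k l} x y : rename.
Arguments idm {k l} x : rename.
Arguments mcomp {k l x y z} g f : rename.

Notation "g \c f" := (mcomp g f) : cat_scope.

Section Abelian.
Variables (k : fieldType) (A : lincat k).
Implicit Types x y z s p : A.

Definition mono x y (f : mor x y) :=
  forall t (g h : mor t x), f \c g = f \c h -> g = h.

Definition epi x y (f : mor x y) :=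
  forall t (g h : mor y t), g \c f = h \c f -> g = h.

Definition is_iso x y (f : mor x y) :=
  exists g : mor y x, g \c f = idm x /\ f \c g = idm y.

Definition isomorphic x y := exists f : mor x y, is_iso f.

Definition zero_object z :=
  forall x, (forall f : mor z x, f = 0) /\ (forall f : mor x z, f = 0).

Definition is_biproduct x y s (i1 : mor x s) (i2 : mor y s)
    (p1 : mor s x) (p2 : mor s y) :=
  [/\ p1 \c i1 = idm x, p2 \c i2 = idm y, p1 \c i2 = 0, p2 \c i1 = 0
    & (i1 \c p1) + (i2 \c p2) = idm s].

Definition is_kernel x y (f : mor x y) z (i : mor z x) :=
  f \c i = 0 /\
  forall t (g : mor t x), f \c g = 0 -> exists! h : mor t z, i \c h = g.

Definition is_cokernel x y (f : mor x y) z (p : mor y z) :=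
  p \c f = 0 /\
  forall t (g : mor y t), g \c f = 0 -> exists! h : mor z t, h \c p = g.

Definition abelian :=
  [/\ exists z, zero_object z,
      forall x y, exists s (i1 : mor x s) (i2 : mor y s)
        (p1 : mor s x) (p2 : mor s y), is_biproduct i1 i2 p1 p2,
      forall x y (f : mor x y),
        (exists z (i : mor z x), is_kernel f i) /\
        (exists z (p : mor y z), is_cokernel f p),
      forall x y (f : mor x y), mono f ->
        exists z (g : mor y z), is_kernel g f
    & forall x y (f : mor x y), epi f ->
        exists z (g : mor z x), is_cokernel g f].

Definition short_exact x y z (i : mor x y) (p : mor y z) :=
  is_kernel p i /\ is_cokernel i p.

Definition projective p :=
  forall x y (e : mor x y), epi e ->
  forall f : mor p y, exists g : mor p x, e \c g = f.

Definition simple s :=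
  ~ zero_object s /\
  forall y (i : mor y s), mono i -> zero_object y \/ is_iso i.

Inductive finite_length : A -> Prop :=
| FiniteLength0 x : zero_object x -> finite_length x
| FiniteLengthS x y s (i : mor x y) (p : mor y s) :
    short_exact i p -> simple s -> finite_length x -> finite_length y.

Definition finite_abelian :=
  [/\ abelian,
      forall x, finite_length x,
      exists n (S : 'I_n -> A), forall s, simple s -> exists j, isomorphic s (S j)
    & forall x, exists p (e : mor p x), projective p /\ epi e].

Record iso x y := Iso {
  fwd : mor x y;
  bwd : mor y x;
  fwdK : bwd \c fwd = idm x;
  bwdK : fwd \c bwd = idm y
}.

End Abelian.

(* Stated for the object and morphism maps of a linear functor, so that it
   applies to partial applications of bifunctors. *)
Definition exact_map (k : fieldType) (A B : lincat k) (F0 : A -> B)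
    (F1 : forall x y : A, mor x y -> mor (F0 x) (F0 y)) :=
  forall (x y z : A) (i : mor x y) (p : mor y z),
    short_exact i p -> short_exact (F1 x y i) (F1 y z p).

Record linfunctor (k : fieldType) (A B : lincat k) := LinFunctor {
  fob :> A -> B;
  fmor : forall x y : A, mor x y -> mor (fob x) (fob y);
  fmor1 : forall x, fmor (idm x) = idm (fob x);
  fmorM : forall x y z (g : mor y z) (f : mor x y),
    fmor (g \c f) = fmor g \c fmor f;
  fmor_linear : forall x y, linear (@fmor x y)
}.
Arguments fmor {k A B} F {x y} f : rename.

Definition exact_functor (k : fieldType) (A B : lincat k)
    (F : linfunctor A B) := exact_map (@fmor k A B F).

Definition right_adjoint (k : fieldType) (A B : lincat k)
    (F : linfunctor A B) (G : linfunctor B A) :=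
  exists phi : forall (x : A) (y : B), mor (F x) y -> mor x (G y),
  [/\ forall x y, bijective (phi x y),
      forall x x' y (h : mor x' x) (f : mor (F x) y),
        phi x' y (f \c fmor F h) = phi x y f \c h
    & forall x y y' (g : mor y y') (f : mor (F x) y),
        phi x y' (g \c f) = fmor G g \c phi x y f].

Record bifunctor (k : fieldType) (A B C : lincat k) := Bifunctor {
  bob : A -> B -> C;
  bmor : forall (x x' : A) (y y' : B),
    mor x x' -> mor y y' -> mor (bob x y) (bob x' y');
  bmor1 : forall x y, bmor (idm x) (idm y) = idm (bob x y);
  bmorM : forall x x' x'' y y' y'' (f' : mor x' x'') (f : mor x x')
      (g' : mor y' y'') (g : mor y y'),
    bmor (f' \c f) (g' \c g) = bmor f' g' \c bmor f g;
  bmor_linearl : forall x x' y y' (g : mor y y'),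
    linear (fun f : mor x x' => bmor f g);
  bmor_linearr : forall x x' y y' (f : mor x x'),
    linear (fun g : mor y y' => bmor f g)
}.
Arguments bob {k A B C} T x y : rename.
Arguments bmor {k A B C} T {x x' y y'} f g : rename.

Record moncat (k : fieldType) := MonCat {
  mon_cat :> lincat k;
  tens : bifunctor mon_cat mon_cat mon_cat
    where "x ⊗ y" := (bob tens x y)
      and "f ⊗₁ g" := (bmor tens f g);
  tunit : mon_cat;
  tassoc : forall x y z, iso ((x ⊗ y) ⊗ z) (x ⊗ (y ⊗ z));
  tlunit : forall x, iso (tunit ⊗ x) x;
  trunit : forall x, iso (x ⊗ tunit) x;
  tassoc_natural : forall x x' y y' z z'
      (f : mor x x') (g : mor y y') (h : mor z z'),
    fwd (tassoc x' y' z') \c ((f ⊗₁ g) ⊗₁ h)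
      = (f ⊗₁ (g ⊗₁ h)) \c fwd (tassoc x y z);
  tlunit_natural : forall x x' (f : mor x x'),
    fwd (tlunit x') \c (idm tunit ⊗₁ f) = f \c fwd (tlunit x);
  trunit_natural : forall x x' (f : mor x x'),
    fwd (trunit x') \c (f ⊗₁ idm tunit) = f \c fwd (trunit x);
  tpentagon : forall w x y z,
    fwd (tassoc w x (y ⊗ z)) \c fwd (tassoc (w ⊗ x) y z)
      = (idm w ⊗₁ fwd (tassoc x y z)) \c fwd (tassoc w (x ⊗ y) z)
          \c (fwd (tassoc w x y) ⊗₁ idm z);
  ttriangle : forall x y,
    (idm x ⊗₁ fwd (tlunit y)) \c fwd (tassoc x tunit y)
      = fwd (trunit x) ⊗₁ idm y
}.
Arguments tens {k} C : rename.
Arguments tunit {k} C : rename.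
Arguments tassoc {k C} x y z : rename.
Arguments tlunit {k C} x : rename.
Arguments trunit {k C} x : rename.

Notation "x ⊗ y" := (bob (tens _) x y) : cat_scope.
Notation "f ⊗₁ g" := (bmor (tens _) f g) : cat_scope.

(* [y] is a left dual of [x], equivalently [x] is a right dual of [y]. *)
Definition dual_pair (k : fieldType) (C : moncat k) (y x : C) :=
  exists (ev : mor (y ⊗ x) (tunit C)) (coev : mor (tunit C) (x ⊗ y)),
    fwd (trunit x) \c (idm x ⊗₁ ev) \c fwd (tassoc x y x) \c (coev ⊗₁ idm x)
      = fwd (tlunit x)
    /\
    fwd (tlunit y) \c (ev ⊗₁ idm y) \c bwd (tassoc y x y) \c (idm y ⊗₁ coev)
      = fwd (trunit y).

Definition rigid (k : fieldType) (C : moncat k) :=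
  forall x : C, (exists y, dual_pair y x) /\ (exists y, dual_pair x y).

(* [1 ≅ End(1)] as algebras over the ground field. *)
Definition simple_unit (k : fieldType) (C : moncat k) :=
  exists phi : k^o -> mor (tunit C) (tunit C),
    [/\ linear phi, phi 1 = idm (tunit C),
        forall a b, phi (a * b) = phi a \c phi b
      & bijective phi].

Record fin_tensor_cat (k : fieldType) := FinTensorCat {
  ftc_mon :> moncat k;
  ftc_finite : finite_abelian ftc_mon;
  ftc_rigid : rigid ftc_mon;
  ftc_unit : simple_unit ftc_mon
}.

Record tensor_functor (k : fieldType) (C D : moncat k) := TensorFunctor {
  tf_fun :> linfunctor C D;
  tf_exact : exact_functor tf_fun;
  tf_mul : forall x y : C, iso (tf_fun x ⊗ tf_fun y) (tf_fun (x ⊗ y));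
  tf_one : iso (tunit D) (tf_fun (tunit C));
  tf_mul_natural : forall x x' y y' (f : mor x x') (g : mor y y'),
    fwd (tf_mul x' y') \c (fmor tf_fun f ⊗₁ fmor tf_fun g)
      = fmor tf_fun (f ⊗₁ g) \c fwd (tf_mul x y);
  tf_assoc : forall x y z,
    fmor tf_fun (fwd (tassoc x y z)) \c fwd (tf_mul (x ⊗ y) z)
        \c (fwd (tf_mul x y) ⊗₁ idm (tf_fun z))
      = fwd (tf_mul x (y ⊗ z)) \c (idm (tf_fun x) ⊗₁ fwd (tf_mul y z))
        \c fwd (tassoc (tf_fun x) (tf_fun y) (tf_fun z));
  tf_lunit : forall x,
    fmor tf_fun (fwd (tlunit x)) \c fwd (tf_mul (tunit C) x)
        \c (fwd tf_one ⊗₁ idm (tf_fun x))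
      = fwd (tlunit (tf_fun x));
  tf_runit : forall x,
    fmor tf_fun (fwd (trunit x)) \c fwd (tf_mul x (tunit C))
        \c (idm (tf_fun x) ⊗₁ fwd tf_one)
      = fwd (trunit (tf_fun x))
}.
Arguments tf_mul {k C D} F x y : rename.
Arguments tf_one {k C D} F : rename.

(* A right adjoint is unique up to natural isomorphism, so quantifying over it
   existentially is harmless. *)
Definition perfect (k : fieldType) (C D : moncat k) (F : tensor_functor C D) :=
  exists G : linfunctor D C, right_adjoint F G /\ exact_functor G.

Record module_cat (k : fieldType) (D : moncat k) := ModuleCat {
  mod_cat :> lincat k;
  mod_finite : finite_abelian mod_cat;
  act : bifunctor D mod_cat mod_cat
    where "x ▷ m" := (bob act x m)
      and "f ▷₁ g" := (bmor act f g);
  act_exactl : forall m : mod_cat,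
    exact_map (fun x y (f : mor x y) => f ▷₁ idm m);
  act_exactr : forall x : D,
    exact_map (fun m n (g : mor m n) => idm x ▷₁ g);
  aassoc : forall (x y : D) (m : mod_cat), iso ((x ⊗ y) ▷ m) (x ▷ (y ▷ m));
  aunit : forall m : mod_cat, iso (tunit D ▷ m) m;
  aassoc_natural : forall x x' y y' m m'
      (f : mor x x') (g : mor y y') (h : mor m m'),
    fwd (aassoc x' y' m') \c ((f ⊗₁ g) ▷₁ h)
      = (f ▷₁ (g ▷₁ h)) \c fwd (aassoc x y m);
  aunit_natural : forall m m' (h : mor m m'),
    fwd (aunit m') \c (idm (tunit D) ▷₁ h) = h \c fwd (aunit m);
  apentagon : forall x y z m,
    fwd (aassoc x y (z ▷ m)) \c fwd (aassoc (x ⊗ y) z m)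
      = (idm x ▷₁ fwd (aassoc y z m)) \c fwd (aassoc x (y ⊗ z) m)
          \c (fwd (tassoc x y z) ▷₁ idm m);
  atriangle : forall x m,
    (idm x ▷₁ fwd (aunit m)) \c fwd (aassoc x (tunit D) m)
      = fwd (trunit x) ▷₁ idm m
}.
Arguments act {k D} M : rename.
Arguments aassoc {k D M} x y m : rename.
Arguments aunit {k D M} m : rename.

Notation "x ▷ m" := (bob (act _) x m) : cat_scope.
Notation "f ▷₁ g" := (bmor (act _) f g) : cat_scope.

Definition exact_module (k : fieldType) (D : moncat k) (M : module_cat D) :=
  forall p : D, projective p -> forall m : M, projective (p ▷ m).

Section BifunctorTheory.
Variables (k : fieldType) (A B E : lincat k) (T : bifunctor A B E).

Lemma bmorMl x x' x'' y (f' : mor x' x'') (f : mor x x') :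
  bmor T (f' \c f) (idm y) = bmor T f' (idm y) \c bmor T f (idm y).
Proof. by rewrite -bmorM mcomp1m. Qed.

Lemma bmorMr x y y' y'' (g' : mor y' y'') (g : mor y y') :
  bmor T (idm x) (g' \c g) = bmor T (idm x) g' \c bmor T (idm x) g.
Proof. by rewrite -bmorM mcomp1m. Qed.

End BifunctorTheory.

Section Restriction.
Variables (k : fieldType) (C D : moncat k) (F : tensor_functor C D).
Variable M : module_cat D.

Definition res_bob (c : C) (m : M) : M := F c ▷ m.

Definition res_bmor (c c' : C) (m m' : M) (f : mor c c') (g : mor m m') :
    mor (res_bob c m) (res_bob c' m') :=
  fmor F f ▷₁ g.

Lemma res_bmor1 c m : res_bmor (idm c) (idm m) = idm (res_bob c m).
Proof. by rewrite /res_bmor fmor1 bmor1. Qed.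

Lemma res_bmorM c c' c'' m m' m'' (f' : mor c' c'') (f : mor c c')
    (g' : mor m' m'') (g : mor m m') :
  res_bmor (f' \c f) (g' \c g) = res_bmor f' g' \c res_bmor f g.
Proof. by rewrite /res_bmor fmorM bmorM. Qed.

Lemma res_bmor_linearl c c' m m' (g : mor m m') :
  linear (fun f : mor c c' => res_bmor f g).
Proof. by move=> a u v; rewrite /res_bmor fmor_linear bmor_linearl. Qed.

Lemma res_bmor_linearr c c' m m' (f : mor c c') :
  linear (fun g : mor m m' => res_bmor f g).
Proof. exact: bmor_linearr. Qed.

Definition res_act : bifunctor C M M :=
  Bifunctor res_bmor1 res_bmorM res_bmor_linearl res_bmor_linearr.

Lemma res_exactl (m : M) :
  exact_map (fun (x y : C) (f : mor x y) => bmor res_act f (idm m)).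
Proof. by move=> x y z i p ex; apply: act_exactl; apply: tf_exact. Qed.

Lemma res_exactr (x : C) :
  exact_map (fun (m n : M) (g : mor m n) => bmor res_act (idm x) g).
Proof.
by move=> m n q i p ex; rewrite /= /res_bmor !fmor1; apply: act_exactr.
Qed.

Section IsoAct.
Variables (x y : D) (j : iso x y) (m n : M) (a : iso (x ▷ m) n).

Definition iso_act_fwd : mor (y ▷ m) n := fwd a \c (bwd j ▷₁ idm m).
Definition iso_act_bwd : mor n (y ▷ m) := (fwd j ▷₁ idm m) \c bwd a.

Lemma iso_act_fwdK : iso_act_bwd \c iso_act_fwd = idm (y ▷ m).
Proof.
rewrite /iso_act_fwd /iso_act_bwd mcompA -[_ \c _ \c fwd _]mcompA fwdK.
by rewrite mcompm1 -bmorMl bwdK bmor1.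
Qed.

Lemma iso_act_bwdK : iso_act_fwd \c iso_act_bwd = idm n.
Proof.
rewrite /iso_act_fwd /iso_act_bwd mcompA.
by rewrite -[_ \c _ \c (fwd _ ▷₁ _)]mcompA -bmorMl fwdK bmor1 mcompm1 bwdK.
Qed.

Definition iso_act : iso (y ▷ m) n := Iso iso_act_fwdK iso_act_bwdK.

End IsoAct.

Definition res_assoc (x y : C) (m : M) :
    iso (bob res_act (x ⊗ y) m) (bob res_act x (bob res_act y m)) :=
  iso_act (tf_mul F x y) (aassoc (F x) (F y) m).

Definition res_unit (m : M) : iso (bob res_act (tunit C) m) m :=
  iso_act (tf_one F) (aunit m).

Lemma bwd_tf_mul_natural x x' y y' (f : mor x x') (g : mor y y') :
  bwd (tf_mul F x' y') \c fmor F (f ⊗₁ g)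
    = (fmor F f ⊗₁ fmor F g) \c bwd (tf_mul F x y).
Proof.
rewrite -[LHS]mcompm1 -(bwdK (tf_mul F x y)) !mcompA.
rewrite -[_ \c _ \c fwd _]mcompA -tf_mul_natural.
by rewrite mcompA fwdK mcomp1m.
Qed.

Lemma res_assoc_natural x x' y y' m m'
    (f : mor x x') (g : mor y y') (h : mor m m') :
  fwd (res_assoc x' y' m') \c bmor res_act (f ⊗₁ g) h
    = bmor res_act f (bmor res_act g h) \c fwd (res_assoc x y m).
Proof.
rewrite /= /res_bmor /iso_act_fwd mcompA -aassoc_natural -!mcompA -!bmorM.
by rewrite mcomp1m mcompm1 bwd_tf_mul_natural.
Qed.

Lemma res_unit_natural m m' (h : mor m m') :
  fwd (res_unit m') \c bmor res_act (idm (tunit C)) h = h \c fwd (res_unit m).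
Proof.
rewrite /= /res_bmor /iso_act_fwd fmor1 mcompA -aunit_natural -!mcompA -!bmorM.
by rewrite !mcomp1m !mcompm1.
Qed.

Lemma bwd_tf_assoc x y z :
  fwd (tassoc (F x) (F y) (F z)) \c (bwd (tf_mul F x y) ⊗₁ idm (F z))
      \c bwd (tf_mul F (x ⊗ y) z)
    = (idm (F x) ⊗₁ bwd (tf_mul F y z)) \c bwd (tf_mul F x (y ⊗ z))
      \c fmor F (fwd (tassoc x y z)).
Proof.
set L := LHS; set R := RHS.
set P := (idm (F x) ⊗₁ bwd (tf_mul F y z)) \c bwd (tf_mul F x (y ⊗ z)).
set Q := (bwd (tf_mul F x y) ⊗₁ idm (F z)) \c bwd (tf_mul F (x ⊗ y) z).
have E := congr1 (fun u => P \c u \c Q) (tf_assoc F x y z).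
have PK : P \c (fwd (tf_mul F x (y ⊗ z)) \c (idm (F x) ⊗₁ fwd (tf_mul F y z)))
    = idm _.
  rewrite /P mcompA -[_ \c _ \c fwd _]mcompA fwdK mcompm1 -bmorMr fwdK.
  exact: bmor1.
have QK : (fwd (tf_mul F (x ⊗ y) z) \c (fwd (tf_mul F x y) ⊗₁ idm (F z))) \c Q
    = idm _.
  rewrite /Q mcompA -[_ \c _ \c (bwd _ ⊗₁ _)]mcompA -bmorMl bwdK bmor1.
  by rewrite mcompm1 bwdK.
move: E; rewrite /= [P \c (_ \c _ \c fwd (tassoc _ _ _))]mcompA PK mcomp1m.
rewrite -[fmor F _ \c _ \c _]mcompA mcompA -[_ \c _ \c Q]mcompA QK mcompm1.
by rewrite /L /R /P /Q mcompA => ->.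
Qed.

Lemma res_pentagon x y z m :
  fwd (res_assoc x y (bob res_act z m)) \c fwd (res_assoc (x ⊗ y) z m)
    = bmor res_act (idm x) (fwd (res_assoc y z m))
        \c fwd (res_assoc x (y ⊗ z) m)
        \c bmor res_act (fwd (tassoc x y z)) (idm m).
Proof.
rewrite /= /res_bmor /res_bob /iso_act_fwd fmor1 bmorMr !mcompA.
have N1 := aassoc_natural (bwd (tf_mul F x y)) (idm (F z)) (idm m).
rewrite bmor1 in N1.
have N2 := aassoc_natural (idm (F x)) (bwd (tf_mul F y z)) (idm m).
rewrite -[_ \c (bwd _ ▷₁ _) \c fwd _]mcompA -N1 mcompA apentagon.
rewrite -[_ \c (idm _ ▷₁ (bwd _ ▷₁ _)) \c fwd _]mcompA -N2.
rewrite -!mcompA; congr (_ \c (_ \c _)).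
by rewrite -!bmorMl !mcompA bwd_tf_assoc.
Qed.

Lemma res_triangle x m :
  bmor res_act (idm x) (fwd (res_unit m)) \c fwd (res_assoc x (tunit C) m)
    = bmor res_act (fwd (trunit x)) (idm m).
Proof.
rewrite /= /res_bmor /res_bob /iso_act_fwd fmor1 bmorMr !mcompA.
have N := aassoc_natural (idm (F x)) (bwd (tf_one F)) (idm m).
rewrite -[_ \c (idm _ ▷₁ (bwd _ ▷₁ _)) \c fwd _]mcompA -N mcompA atriangle.
rewrite -!bmorMl -tf_runit -!mcompA.
congr (_ ▷₁ _); rewrite [(idm _ ⊗₁ _) \c _]mcompA -bmorMr bwdK bmor1 mcomp1m.
by rewrite bwdK mcompm1.
Qed.

(* The category [M] with the action [c ▷ m := F c ▷ m]; its associator and unit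
   constraint are those of [M] precomposed with the inverses of the constraints
   of [F]. *)
Definition restrict : module_cat C :=
  ModuleCat (mod_finite M) res_exactl res_exactr res_assoc_natural
    res_unit_natural res_pentagon res_triangle.

End Restriction.

(* Main.v *)
Require Import Defs.
From mathcomp Require Import all_boot all_algebra.

(** For the forward direction, [F] preserves projectives because its right
    adjoint preserves epimorphisms.  For the converse, choose an epimorphism
    from a projective [q] onto the unit of [C].  Since [- ⊗ p] preserves
    epimorphisms by rigidity, it yields an epimorphism [F q ⊗ p -> p], which
    splits when [p] is projective.  Hence [p ▷ m] is a retract of
    [(F q ⊗ p) ▷ m ≅ F q ▷ (p ▷ m)], which is projective by exactness of the
    restricted module category. *)

Set Implicit Arguments.
Unset Strict Implicit.
Unset Printing Implicit Defensive.

Import GRing.Theory.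
Local Open Scope ring_scope.
Local Open Scope cat_scope.

Section LinearCategory.
Variables (k : fieldType) (A : lincat k).
Implicit Types x y z : A.

Lemma mcompm0 x y z (g : mor y z) : g \c (0 : mor x y) = 0.
Proof.
have := mcomp_linearr (x := x) g 1 0 0; rewrite !scale1r addr0 => E.
by apply: (addrI (g \c 0)); rewrite -E addr0.
Qed.

Lemma mcomp0m x y z (f : mor x y) : (0 : mor y z) \c f = 0.
Proof.
have := mcomp_linearl (z := z) f 1 0 0; rewrite !scale1r addr0 => E.
by apply: (addrI (0 \c f)); rewrite -E addr0.
Qed.

Lemma epi_comp x y z (g : mor y z) (f : mor x y) :
  epi g -> epi f -> epi (g \c f).
Proof. by move=> eg ef t u v; rewrite !mcompA => /ef /eg. Qed.

Lemma epi_fwd x y (j : iso x y) : epi (fwd j).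
Proof.
move=> t u v /(congr1 (fun w => w \c bwd j)).
by rewrite -!mcompA bwdK !mcompm1.
Qed.

Lemma mono_fwd x y (j : iso x y) : mono (fwd j).
Proof.
move=> t u v /(congr1 (fun w => bwd j \c w)).
by rewrite !mcompA fwdK !mcomp1m.
Qed.

Lemma epi_bwd x y (j : iso x y) : epi (bwd j).
Proof.
move=> t u v /(congr1 (fun w => w \c fwd j)).
by rewrite -!mcompA fwdK !mcompm1.
Qed.

Lemma cokernel_epi x y z (f : mor x y) (p : mor y z) : is_cokernel f p -> epi p.
Proof.
case=> pf0 univ t g h gh.
have [|u [_ uniq_u]] := univ t (g \c p); first by rewrite -mcompA pf0 mcompm0.
by rewrite -(uniq_u g erefl) -(uniq_u h (esym gh)).
Qed.

(** Exactness is phrased by short exact sequences, so an epimorphism must be completed to one before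
    an exact functor applies. Since [p] is the cokernel of some [g], and [g] factors through the
    kernel [i] of [p], any map killing [i] kills [g], so [p] is also the cokernel of [i]. *)
Lemma epi_short_exact y z (p : mor y z) :
  abelian A -> epi p -> exists x (i : mor x y), short_exact i p.
Proof.
case=> _ _ ker _ coim ep.
have [w [g [pg0 univ]]] := coim _ _ p ep.
have [[x [i [pi0 iuniv]]] _] := ker _ _ p.
exists x, i; split=> //; split=> // t h hi0.
have [g' [def_g _]] := iuniv _ g pg0.
by apply: univ; rewrite -def_g mcompA hi0 mcomp0m.
Qed.

Lemma projective_retract x y (s : mor x y) (r : mor y x) :
  r \c s = idm x -> projective y -> projective x.
Proof.
move=> rs py a b e ee f; have [g eg] := py _ _ e ee (f \c r).
by exists (g \c s); rewrite mcompA eg -mcompA rs mcompm1.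
Qed.

End LinearCategory.

Lemma exact_functor_epi (k : fieldType) (A B : lincat k) (F : linfunctor A B)
    (x y : A) (e : mor x y) :
  abelian A -> exact_functor F -> epi e -> epi (fmor F e).
Proof.
move=> abA exF /(epi_short_exact abA)[z [i /exF[_]]].
exact: cokernel_epi.
Qed.

(** A lifting problem for [F p] against [e] transposes to one for [p] against [fmor G e]. *)
Lemma projective_left_adjoint (k : fieldType) (A B : lincat k)
    (F : linfunctor A B) (G : linfunctor B A) :
  abelian B -> right_adjoint F G -> exact_functor G ->
  forall p, projective p -> projective (F p).
Proof.
move=> abB [phi [bij_phi natl natr]] exG p pp x y e ee f.
have [g eg] := pp _ _ _ (exact_functor_epi abB exG ee) (phi p y f).
have [psi phiK psiK] := bij_phi p x.
exists (psi g); apply: (bij_inj (bij_phi p y)).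
by rewrite natr psiK.
Qed.

Section Rigid.
Variables (k : fieldType) (C : moncat k).
Implicit Types x y p q : C.

(* The left-hand side is the composite of the counit and unit of the adjunction
   [- ⊗ p ⊣ - ⊗ q], with [y ⊗ trunit p] in place of [trunit (y ⊗ p)]; this
   choice makes Kelly's coherence lemma unnecessary. *)
Lemma zigzag_whisker y p q (ev : mor (q ⊗ p) (tunit C))
    (coev : mor (tunit C) (p ⊗ q)) :
  fwd (trunit p) \c (idm p ⊗₁ ev) \c fwd (tassoc p q p) \c (coev ⊗₁ idm p)
    = fwd (tlunit p) ->
  (idm y ⊗₁ fwd (trunit p)) \c fwd (tassoc y p (tunit C))
    \c (idm (y ⊗ p) ⊗₁ ev) \c fwd (tassoc (y ⊗ p) q p)
    \c ((bwd (tassoc y p q) \c (idm y ⊗₁ coev) \c bwd (trunit y)) ⊗₁ idm p)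
  = idm (y ⊗ p).
Proof.
move=> zz; rewrite !bmorMl.
have N1 := tassoc_natural (idm y) (idm p) ev; rewrite bmor1 in N1.
have N2 := tassoc_natural (idm y) coev (idm p).
(* Naturality and the pentagon pull [y] out to the left, leaving part of the zigzag of [p] under
   [idm y ⊗₁ _]. *)
have -> : (idm y ⊗₁ fwd (trunit p)) \c fwd (tassoc y p (tunit C))
    \c (idm (y ⊗ p) ⊗₁ ev) \c fwd (tassoc (y ⊗ p) q p)
  = (idm y ⊗₁ (fwd (trunit p) \c (idm p ⊗₁ ev) \c fwd (tassoc p q p)))
    \c fwd (tassoc y (p ⊗ q) p) \c (fwd (tassoc y p q) ⊗₁ idm p).
  rewrite -[_ \c _ \c (_ ⊗₁ ev)]mcompA N1 -!mcompA tpentagon.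
  by rewrite !bmorMr !mcompA.
rewrite !mcompA -[_ \c (fwd (tassoc y p q) ⊗₁ _) \c _]mcompA -bmorMl bwdK bmor1.
rewrite mcompm1 -[_ \c fwd _ \c _]mcompA N2 mcompA -bmorMr zz ttriangle.
by rewrite -bmorMl bwdK bmor1.
Qed.

(** With [q] a left dual of [p], [- ⊗ p] is left adjoint to [- ⊗ q]. The transposes of [f] and [g]
    agree after precomposition with [e], hence agree, and a map is determined by its transpose. *)
Lemma tensr_epi x y p (e : mor x y) :
  rigid C -> epi e -> epi (e ⊗₁ idm p).
Proof.
move=> rC ee t f g fg.
have [[q [ev [coev [zz _]]]] _] := rC p.
(* [eta] is the unit of this adjunction. *)
pose eta z := bwd (tassoc z p q) \c (idm z ⊗₁ coev) \c bwd (trunit z).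
pose w z := (idm (z ⊗ p) ⊗₁ ev) \c fwd (tassoc (z ⊗ p) q p) \c (eta z ⊗₁ idm p).
have eta_nat : eta y \c e = ((e ⊗₁ idm p) ⊗₁ idm q) \c eta x.
  have Nr : bwd (trunit y) \c e = (e ⊗₁ idm _) \c bwd (trunit x).
    apply: (mono_fwd (j := trunit y)).
    by rewrite !mcompA bwdK mcomp1m trunit_natural -mcompA bwdK mcompm1.
  have Na : bwd (tassoc y p q) \c (e ⊗₁ idm (p ⊗ q))
      = ((e ⊗₁ idm p) ⊗₁ idm q) \c bwd (tassoc x p q).
    apply: (mono_fwd (j := tassoc y p q)).
    rewrite !mcompA bwdK mcomp1m tassoc_natural bmor1.
    by rewrite -mcompA bwdK mcompm1.
  rewrite /eta !mcompA -Na -!mcompA Nr; congr (_ \c _).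
  by rewrite !mcompA -!bmorM !mcomp1m !mcompm1.
have fg' : (f ⊗₁ idm q) \c eta y = (g ⊗₁ idm q) \c eta y.
  by apply: ee; rewrite -[LHS]mcompA -[RHS]mcompA eta_nat !mcompA -!bmorMl fg.
(* The right-hand side involves [h] only through its transpose. *)
have wE (h : mor (y ⊗ p) t) : h \c fwd (trunit (y ⊗ p)) \c w y
    = fwd (trunit t) \c (idm t ⊗₁ ev) \c fwd (tassoc t q p)
        \c (((h ⊗₁ idm q) \c eta y) ⊗₁ idm p).
  rewrite -trunit_natural /w bmorMl !mcompA.
  rewrite -[_ \c fwd _ \c ((h ⊗₁ _) ⊗₁ _)]mcompA tassoc_natural !mcompA.
  congr (_ \c _ \c _); rewrite -!mcompA; congr (_ \c _).
  by rewrite -!bmorM bmor1 !mcomp1m !mcompm1.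
have : f \c fwd (trunit (y ⊗ p)) \c w y = g \c fwd (trunit (y ⊗ p)) \c w y.
  by rewrite !wE fg'.
pose r := (idm y ⊗₁ fwd (trunit p)) \c fwd (tassoc y p (tunit C)).
have rw : r \c w y = idm _ by rewrite /r /w !mcompA zigzag_whisker.
pose r' := bwd (tassoc y p (tunit C)) \c (idm y ⊗₁ bwd (trunit p)).
have r'r : r' \c r = idm _.
  rewrite /r' /r !mcompA -[_ \c _ \c (_ ⊗₁ fwd _)]mcompA -bmorMr fwdK bmor1.
  by rewrite mcompm1 fwdK.
(* The zigzag makes [w y] a right inverse of the isomorphism [r], hence a two-sided one, so it can
   be cancelled. *)
have wr : w y \c r = idm _.
  by rewrite -[w y]mcomp1m -r'r -[r' \c r \c _]mcompA rw mcompm1.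
move/(congr1 (fun u => u \c r)); rewrite -[LHS]mcompA -[RHS]mcompA wr !mcompm1.
exact: epi_fwd.
Qed.

End Rigid.

Theorem proposition4p4 (k : closedFieldType) (C D : fin_tensor_cat k)
    (F : tensor_functor C D) (hF : perfect F) (M : module_cat D) :
  exact_module M <-> exact_module (restrict F M).
Proof.
have [abC _ _ covC] := ftc_finite C; have [abD _ _ _] := ftc_finite D.
split=> [exM p pp m | exM p pp m].
  have [G [adj exG]] := hF.
  exact/exM/(projective_left_adjoint abD adj exG).
have [q [e [pq ee]]] := covC (tunit C).
have eFe := exact_functor_epi abC (@tf_exact _ _ _ F) ee.
(* The composite [F q ⊗ p -> tunit D ⊗ p -> p]. *)
have eu : epi (fwd (tlunit p) \c ((bwd (tf_one F) \c fmor F e) ⊗₁ idm p)).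
  apply: epi_comp; first exact: epi_fwd.
  apply: tensr_epi; first exact: ftc_rigid.
  by apply: epi_comp eFe; apply: epi_bwd.
have [s us] := pp _ _ _ eu (idm p).
set u := (X in epi X) in eu us.
have := exM q pq (p ▷ m).
apply: (projective_retract (s := fwd (aassoc (F q) p m) \c (s ▷₁ idm m))
                           (r := (u ▷₁ idm m) \c bwd (aassoc (F q) p m))).
rewrite mcompA -[_ \c _ \c fwd _]mcompA fwdK mcompm1 -bmorMl us.
exact: bmor1.
Qed.
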